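(* There exists an infinite family of path-pairable planar graphs $G$ such that, writing $n=|V(G)|$, the maximum degree satisfies $\Delta(G)=\frac{2}{3}n$.
   Context: All graphs are simple and undirected. A graph $G$ on $n$ vertices ($n$ even) is path-pairable if for every pairing of its vertices (i.e. every partition of $V(G)$ into $n/2$ unordered pairs $\{x_i,y_i\}$), there exist pairwise edge-disjoint paths $P_1,\dots,P_{n/2}$ in $G$ such that $P_i$ joins $x_i$ and $y_i$ for each $i$. *)

(* Defs.v *)
From HB Require Import structures.
From mathcomp Require Import all_boot all_order all_algebra.
From mathcomp Require Import all_classical all_reals all_analysis.
Set Implicit Arguments.
Unset Strict Implicit.
Unset Printing Implicit Defensive.
Import Order.TTheory GRing.Theory Num.Theory.
Import numFieldNormedType.Exports.

Local Open Scope ring_scope.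

Record sgraph := SGraph {
  vertex :> finType;
  adj : rel vertex;
  adj_sym : symmetric adj;
  adj_irrefl : irreflexive adj }.

Definition isomorphic (G H : sgraph) : Prop :=
  exists f : G -> H, bijective f /\ forall x y : G, adj (f x) (f y) = adj x y.

Definition edges (G : sgraph) : {set {set G}} :=
  [set [set uv.1; uv.2] | uv : G * G & adj uv.1 uv.2]%SET.

Definition degree (G : sgraph) (v : G) : nat := #|[set w | adj v w]%SET|.

Definition max_degree (G : sgraph) : nat := (\max_(v : G) degree v)%N.

(* A path is given by its list of pairwise distinct vertices, both ends
   included. *)
Definition path_joins (G : sgraph) (x y : G) (p : seq G) : Prop :=
  exists q : seq G,
    [/\ p = x :: q, path (@adj G) x q, last x q = y & uniq (x :: q)].

(* [zip] truncates, so the pairs are those of consecutive vertices of [p]. *)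
Definition path_edges (G : sgraph) (p : seq G) : {set {set G}} :=
  [set [set uv.1; uv.2] | uv in zip p (behead p)]%SET.

Definition pairing (T : finType) (P : {set {set T}}) : Prop :=
  finset.partition P [set: T]%SET /\
  (forall B : {set T}, B \in P -> #|B| = 2%N).

(* Parity is required explicitly: a graph of odd order has no pairing, and
   would satisfy the second clause vacuously. *)
Definition path_pairable (G : sgraph) : Prop :=
  ~~ odd #|G| /\
  forall P : {set {set G}}, pairing P ->
    exists p : {set G} -> seq G,
      (forall B : {set G}, B \in P ->
         exists x y : G, B = [set x; y]%SET /\ path_joins x y (p B)) /\
      (forall B C : {set G}, B \in P -> C \in P -> B != C ->
         [disjoint path_edges (p B) & path_edges (p C)]).

(* A drawing in the plane [R * R] with its product topology: the edge [E] is
   the arc traced by [arc E] on [0, 1], in either of its two orientations; the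
   values of [arc E] outside [0, 1], or when [E] is not an edge, are
   irrelevant. *)
Record plane_drawing (R : realType) (G : sgraph)
    (pos : G -> R * R) (arc : {set G} -> R -> R * R) : Prop := PlaneDrawing {
  pos_inj : injective pos;
  arc_continuous : forall E : {set G}, E \in edges G ->
    {within `[0, 1], continuous (arc E)}%classic;
  arc_inj : forall E : {set G}, E \in edges G ->
    {in `[0, 1] &, injective (arc E)};
  arc_ends : forall E : {set G}, E \in edges G ->
    exists x y : G, [/\ E = [set x; y]%SET, arc E 0 = pos x & arc E 1 = pos y];
  arc_avoids_vertices : forall E : {set G}, E \in edges G ->
    forall (t : R) (v : G), t \in `]0, 1[ -> arc E t <> pos v;
  arc_avoids_arcs : forall E F : {set G}, E \in edges G -> F \in edges G ->
    E != F ->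
    forall s t : R, s \in `]0, 1[ -> t \in `[0, 1] -> arc E s <> arc F t }.

Definition planar (R : realType) (G : sgraph) : Prop :=
  exists (pos : G -> R * R) (arc : {set G} -> R -> R * R),
    plane_drawing pos arc.

(* Main.v *)
(* Take a triangle of hubs and, for each pair of hubs, m further vertices (m odd)
   joined to exactly these two: n = 3(m + 1) and the hubs have degree 2(m + 1).
   Any two non-hubs share a hub, and are joined through it by edges at
   themselves only. The edges of the triangle serve the pairs containing a hub;
   a non-hub paired with the hub h that it misses goes through h + 1, so that
   pairs with distinct hubs never compete for an edge. *)
Require Import Defs.
From mathcomp Require Import all_boot all_order all_algebra.
From mathcomp Require Import all_classical all_reals all_analysis.
From mathcomp Require Import ring lra zify.
Import Order.TTheory GRing.Theory Num.Theory.
Import numFieldNormedType.Exports.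
Local Open Scope ring_scope.

(** * Straight-line drawings of graphs *)

Section StraightLine.
Context {R : realType}.

Definition segment (a b : R * R) (t : R) : R * R :=
  ((1 - t) * a.1 + t * b.1, (1 - t) * a.2 + t * b.2).

Lemma segment_rev (a b : R * R) (t : R) : segment a b t = segment b a (1 - t).
Proof. by rewrite /segment; congr pair; ring. Qed.

Lemma segment0 (a b : R * R) : segment a b 0 = a.
Proof. by case: a => a1 a2; rewrite /segment; congr pair => /=; ring. Qed.

Lemma segment1 (a b : R * R) : segment a b 1 = b.
Proof. by case: b => b1 b2; rewrite /segment; congr pair => /=; ring. Qed.

Lemma segment_inj (a b : R * R) : a <> b -> injective (segment a b).
Proof.
move=> ab s t [e1 e2]; apply/eqP; rewrite -subr_eq0; apply/negPn/negP => st0.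
apply: ab; case: a b e1 e2 => [a1 a2] [b1 b2] /= e1 e2.
by congr pair; apply: (mulfI st0); lra.
Qed.

Lemma segment_continuous (a b : R * R) : continuous (segment a b).
Proof.
have affine (x y : R) : continuous (fun t : R => (1 - t) * x + t * y).
  move=> t; apply: cvgD; apply: cvgM; try exact: cvg_cst; last exact: cvg_id.
  by apply: (@cvgB R R R _ _ (fun=> 1) id); [exact: cvg_cst | exact: cvg_id].
by move=> t; exact: (cvg_pair (affine a.1 b.1 t) (affine a.2 b.2 t)).
Qed.

Lemma straight_line_planar (G : sgraph) (pos : G -> R * R) :
  injective pos ->
  (forall v : G, exists w1 w2 : G, [/\ adj v w1, adj v w2 & w1 <> w2]) ->
  (forall (x y u v : G) (s t : R), adj x y -> adj u v ->
     s \in `]0, 1[ -> t \in `[0, 1] ->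
     segment (pos x) (pos y) s = segment (pos u) (pos v) t ->
     [set x; y]%SET = [set u; v]%SET) ->
  planar R G.
Proof.
move=> pos_inj two_nbrs disj.
(* Edges are unordered, so each gets a chosen orientation; the value off the edges is arbitrary. *)
have /choice[arc arcP] (E : {set G}) : exists a : R -> R * R, E \in edges G ->
    exists x y : G,
      [/\ adj x y, E = [set x; y]%SET & a = segment (pos x) (pos y)].
  case: (boolP (E \in edges G)) => [/imsetP[[x y]]|_]; last by exists (fun=> 0).
  by rewrite inE /= => xy ->; exists (segment (pos x) (pos y)) => _; exists x, y.
exists pos, arc; split=> // [E|E|E|E|E F] /arcP[x [y [xy -> ->]]].
- exact/continuous_subspaceT/segment_continuous.
- move=> s t _ _; apply: segment_inj => /pos_inj eq_xy.
  by rewrite eq_xy adj_irrefl in xy.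
- by exists x, y; rewrite segment0 segment1.
- move=> t v t01 /esym tv; have [w1 [w2 [vw1 vw2 w12]]] := two_nbrs v.
  have on_edge w : adj v w -> [set x; y]%SET = [set v; w]%SET.
    move=> vw; apply: (disj _ _ _ _ t 0) => //; first by rewrite in_itv /=; lra.
    by rewrite segment0.
  have := set22 v w1; rewrite -(on_edge _ vw1) (on_edge _ vw2) !inE.
  by case/orP => /eqP // ew; rewrite ew adj_irrefl in vw1.
- move=> /arcP[u [v [uv -> ->]]] /eqP neq s t s01 t01 eq_st.
  exact: neq (disj _ _ _ _ _ _ xy uv s01 t01 eq_st).
Qed.

End StraightLine.

(** The cases are ring numerals, so that equality tests and sums modulo 3 compute. *)
Lemma ord3_ind (P : 'I_3 -> Prop) :
  P 0 -> P 1 -> P 2%:R -> forall i : 'I_3, P i.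
Proof.
move=> P0 P1 P2 [[|[|[|//]]] lti].
- by rewrite (_ : Ordinal _ = 0) //; exact: val_inj.
- by rewrite (_ : Ordinal _ = 1) //; exact: val_inj.
- by rewrite (_ : Ordinal _ = 2%:R) //; exact: val_inj.
Qed.

(** * The hub graph, its order and its degrees *)

Section HubGraph.
Context (m : nat).

(* [inl h] is a hub; [inr (i, j)] is the [j]-th vertex adjacent to the two
   hubs other than [i]. *)
Definition hub_vertex : finType := ('I_3 + 'I_3 * 'I_m)%type.

Definition hub_adj (x y : hub_vertex) : bool :=
  match x, y with
  | inl h, inl k => h != k
  | inl h, inr (i, _) | inr (i, _), inl h => h != i
  | inr _, inr _ => false
  end.

Lemma hub_adj_sym : symmetric hub_adj.
Proof. by move=> [h|[i j]] [k|[i' j']] //=; rewrite eq_sym. Qed.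

Lemma hub_adj_irrefl : irreflexive hub_adj.
Proof. by move=> [h|[i j]] //=; rewrite eqxx. Qed.

Definition hub_graph : sgraph := SGraph hub_adj_sym hub_adj_irrefl.

Lemma card_hub_graph : #|hub_graph| = (3 * m.+1)%N.
Proof. by rewrite card_sum card_prod !card_ord; lia. Qed.

Lemma degree_hub (h : 'I_3) : @degree hub_graph (inl h) = (2 * m.+1)%N.
Proof.
rewrite /degree.
have -> : [set w : hub_graph | adj (inl h : hub_graph) w]%SET =
    ((inl @: [set~ h]) :|: (inr @: finset.setX [set~ h] [set: 'I_m]))%SET.
  apply/setP => -[k|[i j]]; rewrite !inE /=.
    rewrite mem_imset ?inE; last by move=> ? ? [].
    rewrite [X in _ || X](_ : _ = false) ?orbF; first by rewrite eq_sym.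
    by apply/negP => /imsetP[].
  rewrite [X in X || _](_ : _ = false) /=; last by apply/negP => /imsetP[].
  by rewrite mem_imset ?inE ?andbT 1?eq_sym // => ? ? [].
rewrite cardsU [(_ :&: _)%SET](_ : _ = finset.set0); last first.
  apply/setP => x; rewrite !inE; apply/negP => /andP[/imsetP[? _ ->]].
  by case/imsetP.
rewrite !card_imset; try by move=> ? ? [].
by rewrite cards0 cardsX !cardsC1 cardsT !card_ord; lia.
Qed.

Lemma degree_spoke (i : 'I_3) (j : 'I_m) :
  @degree hub_graph (inr (i, j)) = 2%N.
Proof.
rewrite /degree.
have -> : [set w : hub_graph | adj (inr (i, j) : hub_graph) w]%SET =
    (inl @: [set~ i])%SET.
  apply/setP => -[k|[i' j']]; rewrite !inE /=.
    by rewrite mem_imset ?inE // => ? ? [].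
  by apply/esym/negP => /imsetP[].
by rewrite card_imset ?cardsC1 ?card_ord // => ? ? [].
Qed.

Lemma max_degree_hub_graph : max_degree hub_graph = (2 * m.+1)%N.
Proof.
apply/eqP; rewrite eqn_leq; apply/andP; split.
  apply/bigmax_leqP => -[h|[i j]] _; first by rewrite degree_hub.
  by rewrite degree_spoke; lia.
by rewrite -(degree_hub 0) /max_degree (bigD1 (inl 0)) //= leq_maxl.
Qed.

(** * Edge-disjoint routes by charging edges to end vertices *)

(* The hub [k] is charged to [w]: an edge of a path is charged to an end [w] of
   that path, every vertex [inr _] being charged for its own two edges and every
   hub [h] for the edge [{h, h + 1}]. *)
Definition charged (w : hub_graph) (E : {set hub_graph}) : Prop :=
  exists k : 'I_3, E = [set w; inl k]%SET /\ forall h, w = inl h -> k = h + 1.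

(** If [w] and [w'] differ, the edge joins these two, both are hubs, and each is the successor of
    the other modulo 3, which is impossible. *)
Lemma charged_uniq (w w' : hub_graph) (E : {set hub_graph}) :
  charged w E -> charged w' E -> w = w'.
Proof.
move=> [k [-> wk]] [k' [eE wk']].
have := set21 w (inl k); have := set21 w' (inl k').
rewrite -eE {2}eE !inE => /orP[/eqP //|/eqP ew'] /orP[/eqP //|/eqP ew].
have := wk _ ew; rewrite (wk' _ ew').
by move: k {eE wk wk' ew ew'}; apply: ord3_ind.
Qed.

(** The ends may be swapped because pairs are unordered; a route from a hub to a non-hub is thus one
    from the non-hub. *)
Lemma route_exists (x y : hub_graph) : x <> y ->
  exists (x' y' : hub_graph) (p : seq hub_graph),
    [/\ [set x; y]%SET = [set x'; y']%SET, path_joins x' y' p &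
        forall E, E \in path_edges p ->
          exists2 w, w \in [set x; y]%SET & charged w E].
Proof.
have mid (i i' : 'I_3) : exists2 k, k != i & k != i'.
  by move: i i'; do 2![apply: ord3_ind]; (by exists 0) || (by exists 1)
    || (by exists 2%:R).
have edge2 (u v : hub_graph) E : E \in path_edges [:: u; v] ->
    E = [set u; v]%SET.
  by case/imsetP => uv; rewrite inE => /eqP -> ->.
have edge3 (u v z : hub_graph) E : E \in path_edges [:: u; v; z] ->
    E = [set u; v]%SET \/ E = [set v; z]%SET.
  by case/imsetP => uv; rewrite !inE => /orP[] /eqP -> ->; [left|right].
have spoke_hub (u : 'I_3 * 'I_m) (h : 'I_3) :
    exists p : seq hub_graph, path_joins (inr u : hub_graph) (inl h) p /\
      forall E, E \in path_edges p -> exists2 w,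
        w \in [set (inr u : hub_graph); inl h]%SET & charged w E.
  case: u => i j; case: (eqVneq h i) => [->|hi].
    exists [:: inr (i, j); inl (i + 1); inl i]; split.
      exists [:: inl (i + 1); inl i]; split=> //=; rewrite ?inE ?andbT.
        by move: i; apply: ord3_ind.
      by move: i; apply: ord3_ind.
    move=> E /edge3[] ->; [exists (inr (i, j)) | exists (inl i)];
      rewrite ?set21 ?set22 //; exists (i + 1); split=> //.
      by rewrite finset.setUC.
    by move=> h' [->].
  exists [:: inr (i, j); inl h]; split.
    by exists [:: inl h]; split=> //=; rewrite ?hi.
  by move=> E /edge2 ->; exists (inr (i, j)); rewrite ?set21 //; exists h.
case: x y => [h|u] [k|v] xy.
- have hk : h <> k by move=> e; apply: xy; rewrite e.
  exists (inl h), (inl k), [:: inl h; inl k]; split=> //.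
    by exists [:: inl k]; split=> //=; rewrite ?inE ?andbT; apply/eqP.
  move=> E /edge2 ->.
  (* Of two distinct residues modulo 3 one is the successor of the other; the edge is charged to the
     predecessor. *)
  have [e|e] : k = h + 1 \/ h = k + 1.
    move: h k hk {xy}; do 2![apply: ord3_ind] => // _;
      (by left; apply: val_inj) || (by right; apply: val_inj).
    by exists (inl h); rewrite ?set21 //; exists k; split=> // h' [<-].
  exists (inl k); rewrite ?set22 //; exists h; split=> [|h' [<-] //].
  by rewrite finset.setUC.
- have [p [pj pE]] := spoke_hub v h.
  exists (inr v), (inl h), p; rewrite finset.setUC; split=> //.
- by have [p [pj pE]] := spoke_hub u k; exists (inr u), (inl k), p.
- case: u v xy => [i j] [i' j'] xy; have [k ki ki'] := mid i i'.
  exists (inr (i, j)), (inr (i', j')), [:: inr (i, j); inl k; inr (i', j')].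
  split=> //.
    exists [:: inl k; inr (i', j')]; split=> //=; rewrite ?ki ?ki' //.
    by rewrite !inE /= andbT; apply/eqP.
  move=> E /edge3[] ->; [exists (inr (i, j)) | exists (inr (i', j'))];
    rewrite ?set21 ?set22 //; exists k; split=> //.
  by rewrite finset.setUC.
Qed.

(** An edge common to two routes would be charged to a single vertex lying in both pairs, but
    distinct pairs are disjoint. *)
Lemma hub_graph_path_pairable : odd m -> path_pairable hub_graph.
Proof.
move=> odd_m; split; first by rewrite card_hub_graph oddM /= odd_m.
move=> P [/and3P[_ /finset.trivIsetP trivP _] card2].
have /choice[p pP] (B : {set hub_graph}) : exists p : seq hub_graph, B \in P ->
    (exists x y, B = [set x; y]%SET /\ path_joins x y p) /\
    forall E, E \in path_edges p -> exists2 w, w \in B & charged w E.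
  case: (boolP (B \in P)) => [BP|_]; last by exists [::].
  have /eqP/cards2P[x [y [/eqP xy ->]]] := card2 _ BP.
  have [x' [y' [p [eB pj pE]]]] := route_exists _ _ xy.
  by exists p => _; split=> //; exists x', y'.
exists p; split=> [B BP|B C BP CP BC]; first by have [] := pP _ BP.
rewrite disjoint_subset; apply/fintype.subsetP => E /(proj2 (pP _ BP))[w wB wE].
rewrite inE; apply/negP => /(proj2 (pP _ CP))[w' wC w'E].
have := trivP _ _ BP CP BC; rewrite disjoint_subset => /fintype.subsetP/(_ _ wB).
by rewrite inE (charged_uniq _ _ _ wE w'E) wC.
Qed.

(** * A straight-line drawing in barycentric coordinates *)

Section Drawing.
Context {R : realType}.

(** The shift by 4 keeps every value below 1/3, the coordinate of the centroid. *)
Definition height (j : nat) : R := (j + 4)%:R^-1.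

Lemma height_bounds (j : nat) : 0 < height j /\ 3 * height j < 1.
Proof.
split; first by rewrite invr_gt0 ltr0n addnS.
by rewrite ltr_pdivrMr ?mul1r ?ltr_nat ?ltr0n ?addnS.
Qed.

Lemma height_inj : injective height.
Proof. by move=> i j /invr_inj/eqP; rewrite eqr_nat eqn_add2r => /eqP. Qed.

(* First two barycentric coordinates with respect to the triangle of hubs:
   [inr (i, j)] is on the median from the hub [i], between the centroid and the
   opposite side. *)
Definition hub_pos (x : hub_graph) : R * R :=
  match x with
  | inl h => ((h == 0)%:R, (h == 1)%:R)
  | inr (i, j) =>
      let c k := if i == k then height j else (1 - height j) / 2 in
      (c 0, c 1)
  end.

Lemma hub_pos_inj : injective hub_pos.
Proof.
move=> [h|[i j]] [k|[i' j']] /= [].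
- by move: h k; do 2![apply: ord3_ind] => //= *; exfalso; lra.
- have := height_bounds j'.
  by move: h i'; do 2![apply: ord3_ind] => /= *; exfalso; lra.
- have := height_bounds j.
  by move: k i; do 2![apply: ord3_ind] => /= *; exfalso; lra.
- have := height_bounds j'; have := height_bounds j => bj bj' e1 e2.
  have [-> eh] : i = i' /\ height j = height j'.
    move: i i' e1 e2; do 2![apply: ord3_ind] => /= e1 e2;
      first [by exfalso; lra | by split=> //; lra].
  by have /ord_inj -> := height_inj _ _ eh.
Qed.

(** For fixed hub indices the equations are linear in [s], [t] and the products of these with
    heights, so bounds on the products suffice for [lra]. *)
Lemma hub_pos_disjoint_hub (h k : 'I_3) (y v : hub_graph) (s t : R) :
  adj (inl h : hub_graph) y -> adj (inl k : hub_graph) v ->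
  0 < s < 1 -> 0 <= t <= 1 ->
  segment (hub_pos (inl h)) (hub_pos y) s =
    segment (hub_pos (inl k)) (hub_pos v) t ->
  [set inl h; y]%SET = [set inl k; v]%SET.
Proof.
move=> hy kv s01 t01.
case: y v hy kv => [h'|[i j]] [k'|[i' j']] /= hh' kk' [].
- move: h h' k k' hh' kk'; do 4![apply: ord3_ind] => //= _ _ e1 e2;
    first [by exfalso; lra | by [] | by rewrite finset.setUC].
- have [p0 p1] := height_bounds j'.
  (* At [t = 0] the point is a hub, which is not interior to a side. For [t > 0] all three
     barycentric coordinates are positive, while on a side one vanishes. *)
  have [t0|t0] : t = 0 \/ 0 < t by case: (ltgtP t 0); [lra|right|left].
    by rewrite t0; move: h h' k i' hh' kk'; do 4![apply: ord3_ind] => //= *; exfalso; lra.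
  have tp0 : 0 < t * height j' by rewrite mulr_gt0.
  have tp1 : 3 * (t * height j') < t by rewrite mulrCA gtr_pMr.
  by move: h h' k i' hh' kk'; do 4![apply: ord3_ind] => //= *; exfalso; lra.
- have [p0 p1] := height_bounds j.
  have sp0 : 0 < s * height j by rewrite mulr_gt0 //; lra.
  have sp1 : 3 * (s * height j) < s by rewrite mulrCA gtr_pMr //; lra.
  by move: h i k k' hh' kk'; do 4![apply: ord3_ind] => //= *; exfalso; lra.
(* For [0 < s < 1] the hub [h] has strictly the largest coordinate and [i] strictly the smallest, so
   the point determines both. The two largest differ by [1 - s], and the smallest is
   [s * height j]. *)
have [p0 p1] := height_bounds j; have [q0 q1] := height_bounds j'.
have sp0 : 0 < s * height j by rewrite mulr_gt0 //; lra.
have sp1 : 3 * (s * height j) < s by rewrite mulrCA gtr_pMr //; lra.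
have tq0 : 0 <= t * height j' by rewrite mulr_ge0 //; lra.
have tq1 : 3 * (t * height j') <= t by rewrite mulrCA ler_piMr //; lra.
move=> e1 e2.
have [-> -> st sh] : [/\ h = k, i = i', s = t & s * height j = t * height j'].
  move: h i k i' hh' kk' e1 e2; do 4![apply: ord3_ind] => //= _ _ e1 e2;
    first [by exfalso; lra | by split=> //; lra].
have s0 : s != 0 by lra.
by move: sh; rewrite -st => /(mulfI s0)/height_inj/ord_inj ->.
Qed.

Lemma hub_pos_disjoint (x y u v : hub_graph) (s t : R) :
  adj x y -> adj u v -> s \in `]0, 1[ -> t \in `[0, 1] ->
  segment (hub_pos x) (hub_pos y) s = segment (hub_pos u) (hub_pos v) t ->
  [set x; y]%SET = [set u; v]%SET.
Proof.
(* Every edge has a hub end; starting there may replace [r] by [1 - r], which preserves both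
   parameter intervals. *)
have hub_first (a b : hub_graph) (r : R) : adj a b -> exists h c r',
    [/\ adj (inl h : hub_graph) c, [set a; b]%SET = [set inl h; c]%SET,
        segment (hub_pos a) (hub_pos b) r =
          segment (hub_pos (inl h)) (hub_pos c) r' & r' = r \/ r' = 1 - r].
  case: a b => [h|[i j]] [k|[i' j']] // ab.
  - by exists h, (inl k), r; split=> //; left.
  - by exists h, (inr (i', j')), r; split=> //; left.
  - exists k, (inr (i, j)), (1 - r); split=> //; last by right.
      exact: finset.setUC.
    exact: segment_rev.
move=> /(hub_first _ _ s)[h [c [s' [hc -> -> ss']]]].
move=> /(hub_first _ _ t)[k [d [t' [kd -> -> tt']]]].
rewrite !in_itv /= => s01 t01; apply: hub_pos_disjoint_hub hc kd _ _.
  by case: ss' => ->; lra.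
by case: tt' => ->; lra.
Qed.

Lemma hub_graph_planar : planar R hub_graph.
Proof.
apply: (straight_line_planar _ _ hub_pos_inj); last exact: hub_pos_disjoint.
have two i : exists k k' : 'I_3, [/\ k != i, k' != i & k <> k'].
  move: i; apply: ord3_ind; [exists 1, 2%:R|exists 0, 2%:R|exists 0, 1] => //.
move=> [i|[i j]]; have [k [k' [ki ki' kk']]] := two i;
  exists (inl k), (inl k'); split=> //=; rewrite 1?eq_sym //; by case.
Qed.

End Drawing.
End HubGraph.

Theorem theorem3 (R : realType) :
  exists G : nat -> sgraph,
    (forall i j : nat, i <> j -> ~ isomorphic (G i) (G j)) /\
    (forall i : nat,
       [/\ path_pairable (G i), planar R (G i) &
           (max_degree (G i))%:R = 2 / 3 * #|G i|%:R :> rat]).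
Proof.
(* Here [m = 2i + 1] is odd and the order is [6(i + 1)], so distinct indices give distinct
   orders. *)
exists (fun i => hub_graph i.*2.+1); split=> [i j ij [f [bf _]]|i].
  by have := bij_eq_card bf; rewrite !card_hub_graph; lia.
split; first by apply: hub_graph_path_pairable; rewrite /= odd_double.
  exact: hub_graph_planar.
by rewrite max_degree_hub_graph card_hub_graph !natrM; field.
Qed.
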